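(* Let $r\in\mathbb{N}$ (a positive integer), $\phi(z)=e^{2\pi i/r}z$, and let $\psi(z)=\sum_{k=0}^\infty\hat\psi_kz^k$ be analytic on $\mathbb{D}$ such that $C_{\psi,\phi}$ is a bounded operator on $\mathcal{D}$. Suppose there exist positive integers $s_2>s_1$ such that $\hat\psi_{rs_1}\hat\psi_{rs_2}\hat\psi_{r(s_2-s_1)}=0$ but at least one of these three coefficients is non-zero. Then $W(C_{\psi,\phi})$ contains a circular disk centered at $\hat\psi_0$ with radius $$\frac12\sqrt{(rs_1+1)|\hat\psi_{rs_1}|^2+(rs_2+1)|\hat\psi_{rs_2}|^2+\frac{rs_2+1}{rs_1+1}|\hat\psi_{r(s_2-s_1)}|^2}.$$
   Context: $\mathbb{D}=\{z\in\mathbb{C}:|z|<1\}$. The Dirichlet space $\mathcal{D}$ is the Hilbert space of all holomorphic $f(z)=\sum_{n\ge0}\hat f_nz^n$ on $\mathbb{D}$ with $\sum_{n\ge 0}(n+1)|\hat f_n|^2<\infty$ (equivalently $\int_{\mathbb{D}}|f'|^2dA<\infty$), with inner product $\langle f,g\rangle_{\mathcal{D}}=\sum_{n\ge0}(n+1)\hat f_n\overline{\hat g_n}$. The weighted composition operator is $(C_{\psi,\phi}f)(z)=\psi(z)f(\phi(z))$. The numerical range of a bounded operator $T$ on a Hilbert space $\mathcal{H}$ is $W(T)=\{\langle Tf,f\rangle:f\in\mathcal{H},\|f\|=1\}$. *)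

(* Defs.v *)
From Stdlib Require Export Reals.
From Stdlib Require Import ClassicalEpsilon Lra FunctionalExtensionality.
From Coquelicot Require Export Coquelicot.
Open Scope R_scope.

(* Functions on the unit disk are encoded as total functions [C -> C]; every
   notion below depends only on their values at points of modulus < 1. *)

Definition holomorphic_on_disk (f : C -> C) : Prop :=
  forall z : C, Cmod z < 1 -> @ex_derive C_AbsRing C_NormedModule f z.

(* [f] is holomorphic on the disk with [f z = sum_n a_n z^n] there.  By
   Cauchy's theorem such an [a] exists for every holomorphic [f]; it is unique
   by [coef_unique] below. *)
Definition has_expansion (f : C -> C) (a : nat -> C) : Prop :=
  holomorphic_on_disk f /\
  forall z : C, Cmod z < 1 -> @is_pseries C_AbsRing C_NormedModule a z (f z).

Definition coef (f : C -> C) : nat -> C :=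
  epsilon (inhabits (fun _ : nat => RtoC 0)) (has_expansion f).

Definition dirichlet (f : C -> C) : Prop :=
  exists a : nat -> C, has_expansion f a /\
    ex_series (fun n => (INR n + 1) * Cmod (a n) ^ 2).

Definition CSeries (a : nat -> C) : C :=
  (Series (fun n => Re (a n)), Series (fun n => Im (a n))).

Definition dirichlet_inner (f g : C -> C) : C :=
  CSeries (fun n => ((INR n + 1)%R * coef f n * Cconj (coef g n))%C).

Definition dirichlet_norm (f : C -> C) : R :=
  sqrt (Re (dirichlet_inner f f)).

Definition weighted_comp (psi phi : C -> C) (f : C -> C) : C -> C :=
  fun z => (psi z * f (phi z))%C.

(* Linearity is not required here: it is automatic for [weighted_comp psi phi]. *)
Definition bounded_on_dirichlet (T : (C -> C) -> (C -> C)) : Prop :=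
  (forall f, dirichlet f -> dirichlet (T f)) /\
  exists M : R, forall f, dirichlet f ->
    dirichlet_norm (T f) <= M * dirichlet_norm f.

Definition numerical_range (T : (C -> C) -> (C -> C)) (w : C) : Prop :=
  exists f : C -> C,
    dirichlet f /\ dirichlet_norm f = 1 /\ dirichlet_inner (T f) f = w.

Definition closed_disk (c : C) (rho : R) (w : C) : Prop :=
  Cmod (w - c)%C <= rho.

Definition Cexpi (t : R) : C := (cos t, sin t).

Definition rotation (r : nat) (z : C) : C := (Cexpi (2 * PI / INR r) * z)%C.

Lemma sum_n_pair (u : nat -> C) (n : nat) :
  @sum_n C_AbelianMonoid u n =
  (sum_n (fun k => Re (u k)) n, sum_n (fun k => Im (u k)) n).
Proof.
induction n as [|n IH].
- rewrite !sum_O. now destruct (u 0%nat).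
- rewrite !sum_Sn, IH. reflexivity.
Qed.

Lemma is_pseries_real (a : nat -> C) (x : R) (l : C) :
  @is_pseries C_AbsRing C_NormedModule a (RtoC x) l ->
  is_pseries (fun n => Re (a n)) x (Re l) /\
  is_pseries (fun n => Im (a n)) x (Im l).
Proof.
intros H.
assert (Hpow : forall n, @pow_n C_Ring (RtoC x) n = RtoC (pow_n x n)).
{ induction n as [|n IH]; simpl; [reflexivity|].
  rewrite IH. unfold mult at 1; simpl. now rewrite <- RtoC_mult. }
split; intros P HP.
- assert (HQ : @locally C_UniformSpace l (fun z => P (Re z))).
  { destruct HP as [e He]. exists e. intros y [Hy _]. now apply He. }
  specialize (H _ HQ). unfold filtermap in *.
  revert H. apply filter_imp. intros n. rewrite sum_n_pair. simpl.
  rewrite (sum_n_ext _ (fun k => scal (pow_n x k) (Re (a k)))); [easy|].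
  intros k. change (@scal C_AbsRing C_NormedModule (@pow_n C_Ring (RtoC x) k) (a k))
    with (@pow_n C_Ring (RtoC x) k * a k)%C.
  rewrite Hpow. change (scal (pow_n x k) ?v) with (pow_n x k * v).
  unfold Re, Im; simpl. ring.
- assert (HQ : @locally C_UniformSpace l (fun z => P (Im z))).
  { destruct HP as [e He]. exists e. intros y [_ Hy]. now apply He. }
  specialize (H _ HQ). unfold filtermap in *.
  revert H. apply filter_imp. intros n. rewrite sum_n_pair. simpl.
  rewrite (sum_n_ext _ (fun k => scal (pow_n x k) (Im (a k)))); [easy|].
  intros k. change (@scal C_AbsRing C_NormedModule (@pow_n C_Ring (RtoC x) k) (a k))
    with (@pow_n C_Ring (RtoC x) k * a k)%C.
  rewrite Hpow. change (scal (pow_n x k) ?v) with (pow_n x k * v).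
  unfold Re, Im; simpl. ring.
Qed.

Lemma pseries_eq_coef (a b : nat -> R) (f : R -> R) :
  (forall x, Rabs x < 1 -> is_pseries a x (f x)) ->
  (forall x, Rabs x < 1 -> is_pseries b x (f x)) ->
  forall n, a n = b n.
Proof.
intros Ha Hb n.
assert (Hcv : forall c : nat -> R,
  (forall x, Rabs x < 1 -> is_pseries c x (f x)) -> Rbar_lt 0 (CV_radius c)).
{ intros c Hc.
  destruct (Rbar_lt_le_dec 0 (CV_radius c)) as [h|h]; [exact h|exfalso].
  assert (Hh : Rabs (1/2) < 1) by (rewrite Rabs_pos_eq; lra).
  apply (CV_disk_outside c (1/2)).
  - apply Rbar_le_lt_trans with (1 := h). simpl. rewrite Rabs_pos_eq; lra.
  - specialize (Hc _ Hh). apply is_pseries_R in Hc.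
    apply ex_series_lim_0. now exists (f (1/2)). }
apply PSeries_ext_recip; [now apply Hcv | now apply Hcv |].
exists (mkposreal 1 Rlt_0_1). intros x Hx.
assert (Hx' : Rabs x < 1).
{ change (Rabs (x - 0) < 1) in Hx. now rewrite Rminus_0_r in Hx. }
rewrite (is_pseries_unique _ _ _ (Ha _ Hx')).
now rewrite (is_pseries_unique _ _ _ (Hb _ Hx')).
Qed.

Lemma coef_unique (f : C -> C) (a : nat -> C) :
  has_expansion f a -> coef f = a.
Proof.
intros Ha.
assert (Hc : has_expansion f (coef f)).
{ unfold coef. apply epsilon_spec. now exists a. }
destruct Ha as [_ Ha], Hc as [_ Hc].
assert (Hm : forall x, Rabs x < 1 -> Cmod (RtoC x) < 1).
{ intros x Hx. now rewrite Cmod_R. }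
apply functional_extensionality. intros n.
apply injective_projections.
- apply (pseries_eq_coef (fun k => Re (coef f k)) (fun k => Re (a k))
    (fun x => Re (f (RtoC x)))); intros x Hx; apply is_pseries_real; auto.
- apply (pseries_eq_coef (fun k => Im (coef f k)) (fun k => Im (a k))
    (fun x => Im (f (RtoC x)))); intros x Hx; apply is_pseries_real; auto.
Qed.

(* Main.v *)
Require Import Defs.
From Stdlib Require Import Reals Lra Lia FunctionalExtensionality.
From Coquelicot Require Import Coquelicot.
Open Scope R_scope.

(** Let m = r s1 and n = r s2.  The rotation has order r, so a trinomial
    f = a0 + a1 z^m + a2 z^n satisfies f (phi z) = f z, and the weighted
    composition operator T acts on f as multiplication by psi.  Only the
    coefficients of psi f of index 0, m and n matter for the inner product with
    f.  After dividing a1 and a2 by sqrt (m+1) and sqrt (n+1), so that the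
    Dirichlet norm of f becomes the Euclidean norm of (c0, c1, c2), one finds
      <T f, f> = psi_0 + alpha c0 c1^* + beta c0 c2^* + gamma c1 c2^*
    on unit vectors, with alpha = sqrt (m+1) psi_m, beta = sqrt (n+1) psi_n
    and gamma = sqrt ((n+1)/(m+1)) psi_(n-m)
    ([numerical_range_trinomial]).  The sum of the squared moduli of alpha, beta
    and gamma is the quantity under the square root in the theorem.

    So it is enough that this quadratic form of a strictly triangular 3 x 3
    matrix fills the disk of radius half the Hilbert-Schmidt norm
    ([nilpotent_disk]).  When one of the three entries vanishes, the two
    remaining terms share one of the variables, and the form becomes
    s (alpha x + beta y) with s real.  Taking (x, y) parallel to the conjugate
    of (alpha, beta), its modulus is s sqrt (1 - s^2) times the norm of
    (alpha, beta) and its argument is free; as s sqrt (1 - s^2) takes every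
    value in [0, 1/2], the closed disk is filled ([star_disk]). *)

(** * Quadratic forms of nilpotent matrices of size three *)

(** The witness has (x, y) parallel to the conjugate of (alpha, beta), with the
    length that makes the value equal to v; s is then left to satisfy the
    normalisation, which is a quadratic equation in s^2. *)
Lemma star_disk (alpha beta v : C) :
  alpha <> RtoC 0 \/ beta <> RtoC 0 ->
  Cmod v <= 1 / 2 * sqrt (Cmod alpha ^ 2 + Cmod beta ^ 2) ->
  exists (s : R) (x y : C),
    s ^ 2 + Cmod x ^ 2 + Cmod y ^ 2 = 1 /\
    (s * (alpha * x + beta * y))%C = v.
Proof.
intros hne hv.
set (P := Cmod alpha ^ 2 + Cmod beta ^ 2) in *.
assert (hP : 0 < P).
{ assert (h1 := pow2_ge_0 (Cmod alpha)). assert (h2 := pow2_ge_0 (Cmod beta)).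
  destruct hne as [h|h]; apply Cmod_gt_0 in h; apply (pow_lt _ 2) in h;
    unfold P; lra. }
assert (hv2 : 4 * Cmod v ^ 2 <= P).
{ assert (h := Cmod_ge_0 v). rewrite <- (pow2_sqrt P) by lra. nra. }
set (q := sqrt (1 - 4 * Cmod v ^ 2 / P)).
assert (hr : 4 * Cmod v ^ 2 / P <= 1).
{ apply Rmult_le_reg_r with P; [exact hP|]. unfold Rdiv.
  rewrite Rmult_assoc, Rinv_l by lra. lra. }
assert (hq : q ^ 2 = 1 - 4 * Cmod v ^ 2 / P) by (apply pow2_sqrt; lra).
assert (hq0 : 0 <= q) by apply sqrt_pos.
(* s^2 is the larger root of X^2 - X + |v|^2 / P = 0: unlike the smaller one it
   does not vanish when v = 0. *)
set (s := sqrt ((1 + q) / 2)).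
assert (hs : s ^ 2 = (1 + q) / 2) by (apply pow2_sqrt; lra).
assert (hs0 : 0 < s) by (apply sqrt_lt_R0; lra).
assert (hsP : 0 < s * P) by now apply Rmult_lt_0_compat.
exists s, (v / RtoC (s * P) * Cconj alpha)%C, (v / RtoC (s * P) * Cconj beta)%C.
split.
- rewrite !Cmod_mult, !Cmod_conj, !Cmod_div, !Cmod_R, !Rabs_pos_eq
    by (lra || (intros h; apply RtoC_inj in h; lra)).
  replace (s ^ 2 + (Cmod v / (s * P) * Cmod alpha) ^ 2
    + (Cmod v / (s * P) * Cmod beta) ^ 2)
    with (s ^ 2 + Cmod v ^ 2 / P / s ^ 2) by (unfold P in *; field; lra).
  replace (Cmod v ^ 2 / P) with ((1 - q ^ 2) / 4) by lra.
  rewrite hs. field. lra.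
- replace (RtoC s * (alpha * (v / RtoC (s * P) * Cconj alpha)
    + beta * (v / RtoC (s * P) * Cconj beta)))%C
    with (RtoC s * (v / RtoC (s * P))
      * (alpha * Cconj alpha + beta * Cconj beta))%C by ring.
  rewrite <- !Cmod2_conj, <- RtoC_plus. fold P. rewrite RtoC_mult.
  field. split; intros h; apply RtoC_inj in h; lra.
Qed.

Lemma Cconj_RtoC (s : R) : Cconj (RtoC s) = RtoC s.
Proof. apply injective_projections; simpl; ring. Qed.

(** Each of the three variables occurs in exactly two of the three terms, so if
    one coefficient is zero the variable common to the other two can be taken
    real and factored out, which reduces the claim to [star_disk]. *)
Lemma nilpotent_disk (alpha beta gamma v : C) :
  (alpha * beta * gamma)%C = RtoC 0 ->
  alpha <> RtoC 0 \/ beta <> RtoC 0 \/ gamma <> RtoC 0 ->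
  Cmod v <= 1 / 2 * sqrt (Cmod alpha ^ 2 + Cmod beta ^ 2 + Cmod gamma ^ 2) ->
  exists c0 c1 c2 : C,
    Cmod c0 ^ 2 + Cmod c1 ^ 2 + Cmod c2 ^ 2 = 1 /\
    (alpha * c0 * Cconj c1 + beta * c0 * Cconj c2
      + gamma * c1 * Cconj c2)%C = v.
Proof.
intros hprod hne hv.
assert (h0 : Cmod (RtoC 0) = 0) by apply Cmod_0.
assert (hsq : forall s : R, Cmod (RtoC s) ^ 2 = s ^ 2).
{ intros s. rewrite Cmod_R. now rewrite pow2_abs. }
destruct (Ceq_dec gamma (RtoC 0)) as [hg|hg].
{ destruct (star_disk alpha beta v) as (s & x & y & hn & he).
  - tauto.
  - rewrite hg, h0 in hv. now rewrite pow_i, Rplus_0_r in hv by lia.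
  - exists (RtoC s), (Cconj x), (Cconj y).
    rewrite !Cmod_conj, !Cconj_conj, hsq, hg, <- he.
    split; [lra | ring]. }
destruct (Ceq_dec alpha (RtoC 0)) as [ha|ha].
{ destruct (star_disk beta gamma v) as (s & x & y & hn & he).
  - tauto.
  - rewrite ha, h0 in hv. now rewrite pow_i, Rplus_0_l in hv by lia.
  - exists x, y, (RtoC s).
    rewrite Cconj_RtoC, hsq, ha, <- he.
    split; [lra | ring]. }
assert (hb : beta = RtoC 0).
{ destruct (Ceq_dec beta (RtoC 0)) as [hb|hb]; [exact hb|].
  exfalso. revert hprod. now repeat apply Cmult_neq_0. }
destruct (star_disk alpha gamma v) as (s & x & y & hn & he).
- tauto.
- rewrite hb, h0 in hv. now rewrite (pow_i 2), Rplus_0_r in hv by lia.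
- exists x, (RtoC s), (Cconj y).
  rewrite !Cconj_conj, !Cmod_conj, Cconj_RtoC, hsq, hb, <- he.
  split; [lra | ring].
Qed.

(** * Powers fixed by the rotation *)

Lemma Cexpi_pow (t : R) (n : nat) : (Cexpi t ^ n)%C = Cexpi (INR n * t).
Proof.
induction n as [|n IH].
- unfold Cexpi. simpl. now rewrite Rmult_0_l, cos_0, sin_0.
- rewrite Cpow_S, IH, S_INR. unfold Cexpi, Cmult; simpl.
  replace ((INR n + 1) * t) with (t + INR n * t) by ring.
  rewrite cos_plus, sin_plus. f_equal; ring.
Qed.

Lemma rotation_pow (r s : nat) (z : C) :
  (0 < r)%nat -> (rotation r z ^ (r * s))%C = (z ^ (r * s))%C.
Proof.
intros hr. unfold rotation.
rewrite Cpow_mult_l, Cpow_mult_r, Cexpi_pow.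
replace (INR r * (2 * PI / INR r)) with (2 * PI)
  by (field; apply not_0_INR; lia).
unfold Cexpi. rewrite cos_2PI, sin_2PI.
change (1, 0) with (RtoC 1). rewrite Cpow_1_l. ring.
Qed.

(** * Products of power series with trinomials *)

Definition trinomial (m n : nat) (a0 a1 a2 z : C) : C :=
  (a0 + a1 * z ^ m + a2 * z ^ n)%C.

Definition trinomial_coef (m n : nat) (a0 a1 a2 : C) (k : nat) : C :=
  if Nat.eq_dec k 0 then a0
  else if Nat.eq_dec k m then a1
  else if Nat.eq_dec k n then a2 else RtoC 0.

(** The Taylor coefficients of the product of sum_k u_k z^k with
    a0 + a1 z^m + a2 z^n, as a combination of shifted copies of u. *)
Definition mul_trinomial (m n : nat) (a0 a1 a2 : C) (u : nat -> C) (k : nat) : C :=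
  (a0 * u k + a1 * @PS_incr_n C_AbsRing C_NormedModule u m k
    + a2 * @PS_incr_n C_AbsRing C_NormedModule u n k)%C.

Lemma pow_n_Cpow (z : C) (n : nat) : @pow_n C_Ring z n = (z ^ n)%C.
Proof.
induction n as [|n IH]; [reflexivity|].
rewrite Cpow_S, <- IH. reflexivity.
Qed.

Lemma is_pseries_mul_trinomial (m n : nat) (a0 a1 a2 : C) (u : nat -> C) (z l : C) :
  @is_pseries C_AbsRing C_NormedModule u z l ->
  @is_pseries C_AbsRing C_NormedModule (mul_trinomial m n a0 a1 a2 u) z
    (l * trinomial m n a0 a1 a2 z)%C.
Proof.
intros hu.
assert (hm := is_pseries_incr_n u m z l hu).
assert (hn := is_pseries_incr_n u n z l hu).
rewrite pow_n_Cpow in hm, hn.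
assert (hc : forall c : C, @mult C_Ring z c = @mult C_Ring c z)
  by (intros c; apply Cmult_comm).
assert (H := is_pseries_plus _ _ _ _ _
  (is_pseries_plus _ _ _ _ _ (is_pseries_scal a0 _ _ _ (hc a0) hu)
     (is_pseries_scal a1 _ _ _ (hc a1) hm))
  (is_pseries_scal a2 _ _ _ (hc a2) hn)).
match type of H with is_pseries _ _ ?l' =>
  replace (l * trinomial m n a0 a1 a2 z)%C with l' end.
- exact H.
- unfold trinomial. cbn. ring.
Qed.

Definition one_coef (k : nat) : C := if Nat.eq_dec k 0 then RtoC 1 else RtoC 0.

Lemma is_pseries_one (z : C) :
  @is_pseries C_AbsRing C_NormedModule one_coef z (RtoC 1).
Proof.
unfold is_pseries, is_series.
apply filterlim_ext with (fun _ : nat => RtoC 1); [|apply filterlim_const].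
intros k. induction k as [|k IH].
- rewrite sum_O. cbn. ring.
- rewrite sum_Sn, <- IH. cbn. ring.
Qed.

(** This yields the expansion of a trinomial itself from the case psi = 1 of
    [is_pseries_mul_trinomial]. *)
Lemma mul_trinomial_one (m n : nat) (a0 a1 a2 : C) :
  (0 < m)%nat -> (m < n)%nat ->
  mul_trinomial m n a0 a1 a2 one_coef = trinomial_coef m n a0 a1 a2.
Proof.
intros hm hn. apply functional_extensionality. intros k.
unfold mul_trinomial, trinomial_coef.
rewrite !PS_incr_n_simplify. unfold one_coef.
change (@zero C_NormedModule) with (RtoC 0).
repeat match goal with |- context [if ?b then _ else _] => destruct b end;
  try lia; ring.
Qed.

Lemma mul_trinomial_values (m n : nat) (a0 a1 a2 : C) (u : nat -> C) :
  (0 < m)%nat -> (m < n)%nat ->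
  mul_trinomial m n a0 a1 a2 u 0 = (a0 * u 0%nat)%C /\
  mul_trinomial m n a0 a1 a2 u m = (a0 * u m + a1 * u 0%nat)%C /\
  mul_trinomial m n a0 a1 a2 u n = (a0 * u n + a1 * u (n - m)%nat + a2 * u 0%nat)%C.
Proof.
intros hm hn. unfold mul_trinomial.
rewrite !PS_incr_n_simplify, !Nat.sub_diag.
change (@zero C_NormedModule) with (RtoC 0).
repeat match goal with |- context [if ?b then _ else _] => destruct b end;
  try lia; repeat split; ring.
Qed.

(** * Trinomials in the Dirichlet space *)

(** C carries two normed-module structures over itself: that of an absolute ring
    and [C_NormedModule], whose balls are products of intervals.  The product
    rule [is_derive_mult] lives in the first, while [holomorphic_on_disk] uses the second.
    Differentiability depends only on the norm of the target, which is [Cmod] in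
    both. *)
Lemma is_derive_C_NormedModule (f : C -> C) (z d : C) :
  @is_derive C_AbsRing (AbsRing_NormedModule C_AbsRing) f z d ->
  @is_derive C_AbsRing C_NormedModule f z d.
Proof.
intros [[h1 h2 h3] H]. split.
- split; [exact h1 | exact h2 | exact h3].
- intros x hx e. generalize (H x hx e). apply filter_imp. intros y hy. exact hy.
Qed.

Lemma ex_derive_Cpow (n : nat) (z : C) :
  exists d : C,
    @is_derive C_AbsRing (AbsRing_NormedModule C_AbsRing) (fun x : C => (x ^ n)%C) z d.
Proof.
induction n as [|n [d hd]].
- exists (RtoC 0).
  exact (is_derive_const (V := AbsRing_NormedModule C_AbsRing) (RtoC 1) z).
- eexists. apply (is_derive_mult (K := C_AbsRing) (fun x : C => x)
    (fun x : C => (x ^ n)%C) z (RtoC 1) d).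
  + exact (is_derive_id z).
  + exact hd.
  + exact Cmult_comm.
Qed.

Lemma trinomial_holomorphic (m n : nat) (a0 a1 a2 : C) :
  holomorphic_on_disk (trinomial m n a0 a1 a2).
Proof.
intros z _.
assert (hconst : forall a : C, @is_derive C_AbsRing (AbsRing_NormedModule C_AbsRing)
  (fun _ : C => a) z (RtoC 0)).
{ intros a. exact (is_derive_const (V := AbsRing_NormedModule C_AbsRing) a z). }
destruct (ex_derive_Cpow m z) as [d hd], (ex_derive_Cpow n z) as [e he].
assert (hm := is_derive_mult (K := C_AbsRing) _ _ z _ _ (hconst a1) hd Cmult_comm).
assert (hn := is_derive_mult (K := C_AbsRing) _ _ z _ _ (hconst a2) he Cmult_comm).
eexists. apply is_derive_C_NormedModule.
exact (is_derive_plus _ _ _ _ _ (is_derive_plus _ _ _ _ _ (hconst a0) hm) hn).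
Qed.

Lemma trinomial_expansion (m n : nat) (a0 a1 a2 : C) :
  (0 < m)%nat -> (m < n)%nat ->
  has_expansion (trinomial m n a0 a1 a2) (trinomial_coef m n a0 a1 a2).
Proof.
intros hm hn. split; [apply trinomial_holomorphic|].
intros z _. rewrite <- mul_trinomial_one by assumption.
rewrite <- (Cmult_1_l (trinomial m n a0 a1 a2 z)).
apply is_pseries_mul_trinomial, is_pseries_one.
Qed.

(** * Dirichlet inner products with trinomials *)

Lemma is_series_single (k : nat) (c : R) :
  is_series (fun i => if Nat.eq_dec i k then c else 0) c.
Proof.
unfold is_series.
apply filterlim_ext_loc with (fun _ : nat => c); [|apply filterlim_const].
assert (H : forall N, sum_n (fun i => if Nat.eq_dec i k then c else 0) N
  = if Compare_dec.le_lt_dec k N then c else 0).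
{ induction N as [|N IH].
  - rewrite sum_O. destruct Nat.eq_dec, Compare_dec.le_lt_dec; (lia || reflexivity).
  - rewrite sum_Sn, IH. change plus with Rplus.
    destruct Nat.eq_dec, Compare_dec.le_lt_dec, Compare_dec.le_lt_dec; (lia || lra). }
exists k. intros N hN. rewrite H. destruct Compare_dec.le_lt_dec; [reflexivity | lia].
Qed.

Lemma is_series_three (m n : nat) (u : nat -> R) :
  (0 < m)%nat -> (m < n)%nat ->
  (forall k, k <> 0%nat -> k <> m -> k <> n -> u k = 0) ->
  is_series u (u 0%nat + u m + u n).
Proof.
intros hm hn hu.
eapply is_series_ext;
  [|exact (is_series_plus _ _ _ _
    (is_series_plus _ _ _ _ (is_series_single 0 (u 0%nat)) (is_series_single m (u m)))
    (is_series_single n (u n)))].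
intros k. cbv beta. change plus with Rplus.
repeat match goal with |- context [if ?b then _ else _] => destruct b end;
  subst; try lia; rewrite ?hu by lia; lra.
Qed.

Lemma CSeries_three (m n : nat) (u : nat -> C) :
  (0 < m)%nat -> (m < n)%nat ->
  (forall k, k <> 0%nat -> k <> m -> k <> n -> u k = RtoC 0) ->
  CSeries u = (u 0%nat + u m + u n)%C.
Proof.
intros hm hn hu. unfold CSeries.
apply injective_projections; apply is_series_unique.
- apply (is_series_three m n (fun k => Re (u k)) hm hn).
  intros k h0 h1 h2. now rewrite hu.
- apply (is_series_three m n (fun k => Im (u k)) hm hn).
  intros k h0 h1 h2. now rewrite hu.
Qed.

Lemma inner_trinomial (m n : nat) (a0 a1 a2 : C) (g : C -> C) (b : nat -> C) :
  (0 < m)%nat -> (m < n)%nat -> has_expansion g b ->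
  dirichlet_inner g (trinomial m n a0 a1 a2) =
  (b 0%nat * Cconj a0 + (INR m + 1)%R * b m * Cconj a1
    + (INR n + 1)%R * b n * Cconj a2)%C.
Proof.
intros hm hn hg. unfold dirichlet_inner.
rewrite (coef_unique _ _ hg), (coef_unique _ _ (trinomial_expansion m n a0 a1 a2 hm hn)).
rewrite (CSeries_three m n); try assumption.
- unfold trinomial_coef.
  repeat match goal with |- context [if ?b then _ else _] => destruct b end;
    try lia. simpl INR. rewrite Rplus_0_l. ring.
- intros k h0 h1 h2. unfold trinomial_coef.
  repeat match goal with |- context [if ?b then _ else _] => destruct b end;
    try lia.
  rewrite Cconj_RtoC. ring.
Qed.

Lemma trinomial_dirichlet (m n : nat) (a0 a1 a2 : C) :
  (0 < m)%nat -> (m < n)%nat -> dirichlet (trinomial m n a0 a1 a2).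
Proof.
intros hm hn. exists (trinomial_coef m n a0 a1 a2).
split; [now apply trinomial_expansion|].
eexists. apply (is_series_three m n); try assumption.
intros k h0 h1 h2. unfold trinomial_coef.
repeat match goal with |- context [if ?b then _ else _] => destruct b end;
  try lia. rewrite Cmod_0. ring.
Qed.

Lemma trinomial_norm (m n : nat) (a0 a1 a2 : C) :
  (0 < m)%nat -> (m < n)%nat ->
  dirichlet_norm (trinomial m n a0 a1 a2) =
  sqrt (Cmod a0 ^ 2 + (INR m + 1) * Cmod a1 ^ 2 + (INR n + 1) * Cmod a2 ^ 2).
Proof.
intros hm hn. unfold dirichlet_norm. f_equal.
rewrite (inner_trinomial _ _ _ _ _ _ _ hm hn (trinomial_expansion _ _ a0 a1 a2 hm hn)).
unfold trinomial_coef.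
repeat match goal with |- context [if ?b then _ else _] => destruct b end;
  try lia.
rewrite <- !Cmult_assoc, <- !Cmod2_conj, <- !RtoC_mult, <- !RtoC_plus. reflexivity.
Qed.

(** * Values of the numerical range *)

(** Since m and n are multiples of r, the trinomial is invariant under the
    rotation, so the operator multiplies it by psi.  Boundedness of the operator
    provides the holomorphy of that product. *)
Lemma numerical_range_trinomial (r s1 s2 : nat) (psi : C -> C) (u : nat -> C)
    (a0 a1 a2 : C) :
  let m := (r * s1)%nat in let n := (r * s2)%nat in
  (0 < r)%nat -> (0 < s1)%nat -> (s1 < s2)%nat ->
  has_expansion psi u ->
  bounded_on_dirichlet (weighted_comp psi (rotation r)) ->
  Cmod a0 ^ 2 + (INR m + 1) * Cmod a1 ^ 2 + (INR n + 1) * Cmod a2 ^ 2 = 1 ->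
  numerical_range (weighted_comp psi (rotation r))
    (u 0%nat + (INR m + 1)%R * u m * a0 * Cconj a1
     + (INR n + 1)%R * u n * a0 * Cconj a2
     + (INR n + 1)%R * u (n - m)%nat * a1 * Cconj a2)%C.
Proof.
intros m n hr hs1 hs2 hpsi [hT _] hnorm.
assert (hm : (0 < m)%nat) by (unfold m; nia).
assert (hn : (m < n)%nat) by (unfold m, n; nia).
assert (hd := trinomial_dirichlet m n a0 a1 a2 hm hn).
exists (trinomial m n a0 a1 a2).
split; [exact hd|]. split.
{ rewrite trinomial_norm, hnorm by assumption. apply sqrt_1. }
destruct (hT _ hd) as (b & [hhol _] & _).
assert (he : has_expansion (weighted_comp psi (rotation r) (trinomial m n a0 a1 a2))
  (mul_trinomial m n a0 a1 a2 u)).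
{ split; [exact hhol|]. intros z hz. unfold weighted_comp.
  replace (trinomial m n a0 a1 a2 (rotation r z)) with (trinomial m n a0 a1 a2 z).
  - apply is_pseries_mul_trinomial. now apply hpsi.
  - unfold trinomial, m, n. now rewrite !rotation_pow. }
rewrite (inner_trinomial _ _ _ _ _ _ _ hm hn he).
destruct (mul_trinomial_values m n a0 a1 a2 u hm hn) as (-> & -> & ->).
assert (hnC : (a0 * Cconj a0 + (INR m + 1)%R * (a1 * Cconj a1)
  + (INR n + 1)%R * (a2 * Cconj a2))%C = RtoC 1).
{ rewrite <- !Cmod2_conj, <- !RtoC_mult, <- !RtoC_plus. now rewrite hnorm. }
rewrite <- (Cmult_1_r (u 0%nat)) at 4. rewrite <- hnC. ring.
Qed.

Theorem theorem4p1 (r : nat) (hr : (0 < r)%nat)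
  (psi : C -> C) (psihat : nat -> C)
  (hpsi : has_expansion psi psihat)
  (hbdd : bounded_on_dirichlet (weighted_comp psi (rotation r)))
  (s1 s2 : nat) (hs1 : (0 < s1)%nat) (hs12 : (s1 < s2)%nat)
  (hprod : (psihat (r * s1)%nat * psihat (r * s2)%nat
            * psihat (r * (s2 - s1))%nat)%C = RtoC 0)
  (hne : psihat (r * s1)%nat <> RtoC 0 \/ psihat (r * s2)%nat <> RtoC 0 \/
         psihat (r * (s2 - s1))%nat <> RtoC 0) :
  forall w : C,
    closed_disk (psihat 0%nat)
      (1 / 2 * sqrt
        ((INR (r * s1) + 1) * Cmod (psihat (r * s1)%nat) ^ 2
         + (INR (r * s2) + 1) * Cmod (psihat (r * s2)%nat) ^ 2
         + (INR (r * s2) + 1) / (INR (r * s1) + 1)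
           * Cmod (psihat (r * (s2 - s1))%nat) ^ 2)) w ->
    numerical_range (weighted_comp psi (rotation r)) w.
Proof.
intros w hw. unfold closed_disk in hw.
assert (hsub : (r * (s2 - s1))%nat = (r * s2 - r * s1)%nat) by nia.
rewrite hsub in *.
set (p := INR (r * s1) + 1) in *. set (q := INR (r * s2) + 1) in *.
set (A := psihat (r * s1)%nat) in *. set (B := psihat (r * s2)%nat) in *.
set (G := psihat (r * s2 - r * s1)%nat) in *.
assert (hp : 0 < p) by apply INRp1_pos.
assert (hq : 0 < q) by apply INRp1_pos.
assert (hsp := sqrt_lt_R0 p hp). assert (hsq := sqrt_lt_R0 q hq).
assert (hp2 : p = sqrt p * sqrt p) by (rewrite sqrt_sqrt; lra).
assert (hq2 : q = sqrt q * sqrt q) by (rewrite sqrt_sqrt; lra).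
set (sp := sqrt p) in *. set (sq := sqrt q) in *.
assert (hsp0 : RtoC sp <> RtoC 0) by (intros h; apply RtoC_inj in h; lra).
assert (hsq0 : RtoC sq <> RtoC 0) by (intros h; apply RtoC_inj in h; lra).
assert (hmod : forall x : R, 0 < x -> Cmod (RtoC x) = x).
{ intros x hx. rewrite Cmod_R. apply Rabs_pos_eq. lra. }
assert (hr0 : 0 < sq / sp) by now apply Rdiv_lt_0_compat.
assert (hrC : RtoC (sq / sp) <> RtoC 0) by (intros h; apply RtoC_inj in h; lra).
destruct (nilpotent_disk (RtoC sp * A) (RtoC sq * B) (RtoC (sq / sp) * G)
  (w - psihat 0%nat)) as (c0 & c1 & c2 & hn & he).
- replace (RtoC sp * A * (RtoC sq * B) * (RtoC (sq / sp) * G))%C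
    with (RtoC sp * RtoC sq * RtoC (sq / sp) * (A * B * G))%C by ring.
  rewrite hprod. ring.
- destruct hne as [h|[h|h]]; [left|right;left|right;right]; now apply Cmult_neq_0.
- eapply Rle_trans; [exact hw|]. right. do 2 f_equal.
  rewrite !Cmod_mult, !hmod, !Rpow_mult_distr by assumption.
  rewrite hp2, hq2. field. lra.
(* The monomials z^m and z^n have Dirichlet norms sp and sq. *)
- set (a1 := (c1 / sp)%C). set (a2 := (c2 / sq)%C).
  replace w with (psihat 0%nat + p * A * c0 * Cconj a1
    + q * B * c0 * Cconj a2 + q * G * a1 * Cconj a2)%C.
  + apply numerical_range_trinomial; try assumption.
    fold p q. rewrite <- hn. unfold a1, a2, Cdiv.
    rewrite !Cmod_mult, !Cmod_inv, !hmod by assumption.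
    rewrite hp2, hq2. field. lra.
  + replace w with (psihat 0%nat + (w - psihat 0%nat))%C by ring.
    rewrite <- he. unfold a1, a2. rewrite !Cdiv_conj, !Cconj_RtoC by assumption.
    rewrite hp2, hq2, !RtoC_mult, RtoC_div by lra. field. now split.
Qed.
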